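(* Let $T$ be a normal rank-one transformation given by a cutting and stacking construction such that for every $N\in\mathbb N$ and all $d_i,d_i',e_i,e_i'\in H_i$ ($0\le i\le N-1$), the equality $\sum_{i=0}^{N-1}(d_i-d_i')=\sum_{i=0}^{N-1}(e_i-e_i')$ implies $d_i-d_i'=e_i-e_i'$ for all $0\le i\le N-1$. Then $T$ is not rationally weakly mixing.
   Context: Cutting and stacking: $C_0$ is a single level $I$ of positive finite measure; column $C_n$ of height $h_n$ is cut into $r_n\ge2$ equal-width subcolumns, $s_{n,k}\ge0$ spacers are placed above the $k$-th subcolumn, subcolumns stacked left to right form $C_{n+1}$; $T$ maps each level to the one above. $h_{n,k}=h_n+s_{n,k}$, $H_n=\{0\}\cup\{\sum_{k=0}^{i}h_{n,k}:0\le i<r_n-1\}$. $T$ is normal if $s_{n,r_n-1}>0$ for infinitely many $n$. For $F$ of positive finite measure, $u_k(F)=\mu(F\cap T^kF)/\mu(F)^2$, $a_n(F)=\sum_{k=0}^{n-1}u_k(F)$. $T$ is rationally weakly mixing if there is $F$ of finite positive measure with $\mu(X\setminus\bigcup_{i\ge0}T^iF)=0$ such that for all measurable $A,B\subseteq F$, $\frac{1}{a_n(F)}\sum_{k=0}^{n-1}|\mu(A\cap T^kB)-\mu(A)\mu(B)u_k(F)|\to0$. *)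

(* Defs.v *)
From HB Require Import structures.
From mathcomp Require Import all_boot all_order all_algebra.
From mathcomp Require Import all_classical all_reals.
From mathcomp Require Import ereal topology normedtype sequences measure lebesgue_measure.

Set Implicit Arguments.
Unset Strict Implicit.
Unset Printing Implicit Defensive.

Import Order.TTheory GRing.Theory Num.Theory.
Import numFieldNormedType.Exports.
Local Open Scope classical_set_scope.
Local Open Scope ring_scope.

(* Concrete model of a rank-one cutting-and-stacking construction on the
   real line with Lebesgue measure.
   Parameters: [ell > 0] the length of C_0 = I = [0, ell);
   [r n] the number of subcolumns of C_n; [s n k] the number of spacers
   placed above the k-th subcolumn of C_n.
   Each level is a half-open interval [c, c + w n) where [w n] is the common
   width of the levels of C_n; a column is represented by the sequence of the
   left endpoints of its levels, from bottom to top.  Spacers are taken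
   from fresh space [M n, ...) to the right of everything used so far. *)

Section CuttingStacking.
Variables (R : realType) (ell : R) (r : nat -> nat) (s : nat -> nat -> nat).

Definition cs_width (n : nat) : R := ell / (\prod_(m < n) r m)%:R.

(* (left endpoints of the levels of C_n, right end of the space used so far) *)
Fixpoint cs_colM (n : nat) : seq R * R :=
  match n with
  | 0 => ([:: 0], ell)
  | n'.+1 =>
      let cM := cs_colM n' in
      let c := cM.1 in let M := cM.2 in
      let wn := cs_width n'.+1 in
      (flatten [seq [seq x + k%:R * wn | x <- c] ++
                    [seq M + ((\sum_(k' < k) s n' k') + t)%:R * wn
                    | t <- iota 0 (s n' k)]
               | k <- iota 0 (r n')],
       M + (\sum_(k < r n') s n' k)%:R * wn)
  end.

Definition cs_col (n : nat) : seq R := (cs_colM n).1.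

Definition cs_h (n : nat) : nat := size (cs_col n).

Definition cs_level (n j : nat) : set R :=
  [set x | nth 0 (cs_col n) j <= x < nth 0 (cs_col n) j + cs_width n].

Definition cs_X : set R :=
  [set x | exists n j, (j < cs_h n)%N /\ cs_level n j x].

Definition cs_hnk (n k : nat) : nat := (cs_h n + s n k)%N.

Definition cs_H (n : nat) : seq nat :=
  0%N :: [seq (\sum_(k < i.+1) cs_hnk n k)%N | i <- iota 0 (r n).-1].

Definition cs_Tdom (x : R) : Prop :=
  exists nj : nat * nat, (nj.2.+1 < cs_h nj.1)%N /\ cs_level nj.1 nj.2 x.

(* T maps each level to the one above (by translation); on the null set
   where it is not determined by the construction, T is the identity. *)
Definition cs_T (x : R) : R :=
  match pselect (cs_Tdom x) with
  | left e => let nj := sval (cid e) in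
      x - nth 0 (cs_col nj.1) nj.2 + nth 0 (cs_col nj.1) nj.2.+1
  | right _ => x
  end.

End CuttingStacking.

Definition cs_normal (s : nat -> nat -> nat) (r : nat -> nat) : Prop :=
  forall N : nat, exists2 n : nat, (N <= n)%N & (0 < s n (r n).-1)%N.

Section RWM.
Variable R : realType.
Local Notation mu := (@lebesgue_measure R).

(* real value of the measure (used only on sets of finite measure) *)
Definition muR (A : set R) : R := fine (mu A).

Definition u_k (T : R -> R) (k : nat) (F : set R) : R :=
  muR (F `&` (iter k T) @` F) / (muR F) ^+ 2.

Definition a_n (T : R -> R) (n : nat) (F : set R) : R :=
  \sum_(k < n) u_k T k F.

Definition rationally_weakly_mixing (X : set R) (T : R -> R) : Prop :=
  exists F : set R,
    [/\ measurable F, F `<=` X, (0 < mu F < +oo)%E,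
        mu (X `\` \bigcup_i ((iter i T) @` F)) = 0%E &
        forall A B : set R, measurable A -> measurable B ->
          A `<=` F -> B `<=` F ->
          (fun n : nat => (a_n T n F)^-1 *
             \sum_(k < n) `| muR (A `&` (iter k T) @` B)
                             - muR A * muR B * u_k T k F |) @ \oo --> 0].
End RWM.

(* Main.v *)
Require Import Defs.
From HB Require Import structures.
From mathcomp Require Import all_boot all_order all_algebra.
From mathcomp Require Import all_classical all_reals.
From mathcomp Require Import ereal topology normedtype sequences measure lebesgue_measure.
From mathcomp Require Import zify ring lra.
(** Suppose that F witnesses rational weak mixing.  Since the level widths tend
    to 0, some level J of C_n meets F in more than the width of a level of C_N,
    so that there are two distinct levels p, p' of C_N inside J for which
    A = F n J n p and B = F n J n p' have positive measure.  If A meets T^k A,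
    then k is a sum of differences of elements of H_i with i >= N; if A meets
    T^k B, then k is such a sum plus the height difference of p and p', which is
    a sum of differences of elements of H_i with i < N.  Uniqueness of digits
    excludes that both occur for the same k, and then the two averages attached
    to (A, A) and (A, B) cannot both tend to 0. *)

Set Implicit Arguments.
Unset Strict Implicit.
Unset Printing Implicit Defensive.

Import Order.TTheory GRing.Theory Num.Theory.
Local Open Scope ring_scope.

(** * Positions of the levels of a column as natural numbers *)

Lemma big_iota0 (F : nat -> nat) (k : nat) :
  (\sum_(i <- iota 0 k) F i = \sum_(i < k) F i)%N.
Proof. by rewrite -(big_mkord xpredT F) /index_iota subn0. Qed.

Lemma nth_flatten_block (T : Type) (x0 : T) (f : nat -> seq T) (m k j : nat) :
  (k < m)%N -> (j < size (f k))%N ->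
  nth x0 (flatten [seq f i | i <- iota 0 m]) ((\sum_(i < k) size (f i)) + j)%N =
  nth x0 (f k) j.
Proof.
move=> km jk.
have -> : m = (k + (m - k.+1).+1)%N by lia.
rewrite iotaD map_cat flatten_cat nth_cat size_flatten /shape -map_comp.
rewrite sumnE big_map big_iota0 ltnNge leq_addr /=.
by rewrite addKn add0n nth_cat jk.
Qed.

Section Columns.
Variables (r : nat -> nat) (s : nat -> nat -> nat).
Hypothesis r_ge2 : forall n, (2 <= r n)%N.

(* Left endpoints of the levels of C_n in units of the level width: the spacers
   are laid out consecutively, so that they fill the interval [0, h_n). *)
Fixpoint col_pos (n : nat) : seq nat :=
  if n is n'.+1 then
    flatten [seq [seq (q * r n' + k)%N | q <- col_pos n'] ++
                 [seq (size (col_pos n') * r n' + (\sum_(k' < k) s n' k' + t))%N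
                 | t <- iota 0 (s n' k)]
            | k <- iota 0 (r n')]
  else [:: 0%N].

Let h n := size (col_pos n).

(** The height in [C_{n+1}] at which the [k]-th subcolumn of [C_n] starts. For [k < r n] these are
    the elements of [H_n]; for [k = r n] it is the height of [C_{n+1}]. *)
Definition col_offset (n k : nat) : nat := (\sum_(i < k) (h n + s n i))%N.

Lemma col_offsetS n k : col_offset n k.+1 = (col_offset n k + (h n + s n k))%N.
Proof. by rewrite /col_offset big_ord_recr. Qed.

Lemma col_offset_mono n k l : (k <= l)%N -> (col_offset n k <= col_offset n l)%N.
Proof.
elim: l => [|l IH]; first by rewrite leqn0 => /eqP ->.
rewrite leq_eqVlt => /orP[/eqP -> //|]; rewrite ltnS => /IH kl.
by rewrite col_offsetS (leq_trans kl)// leq_addr.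
Qed.

Lemma size_col_posS n : h n.+1 = col_offset n (r n).
Proof.
rewrite /h /= size_flatten /shape -map_comp sumnE big_map big_iota0 /col_offset.
by apply: eq_bigr => i _ /=; rewrite size_cat !size_map size_iota.
Qed.

Lemma size_col_posSE n : h n.+1 = (h n * r n + \sum_(k < r n) s n k)%N.
Proof.
by rewrite size_col_posS /col_offset big_split /= sum_nat_const card_ord mulnC.
Qed.

Lemma size_col_pos_gt0 n : (0 < h n)%N.
Proof.
elim: n => // n IH; rewrite size_col_posSE addn_gt0 muln_gt0 IH.
by rewrite (leq_trans _ (r_ge2 n)).
Qed.

Lemma nth_col_posS n k j : (k < r n)%N -> (j < h n)%N ->
  nth 0%N (col_pos n.+1) (col_offset n k + j) =
  (nth 0%N (col_pos n) j * r n + k)%N.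
Proof.
move=> kr jh; set f := fun k : nat =>
  [seq (q * r n + k)%N | q <- col_pos n] ++
  [seq (size (col_pos n) * r n + (\sum_(k' < k) s n k' + t))%N
  | t <- iota 0 (s n k)].
have szf i : size (f i) = (h n + s n i)%N by rewrite size_cat !size_map size_iota.
have := @nth_flatten_block _ 0%N f (r n) k j kr.
rewrite szf (eq_bigr _ (fun (i : 'I_k) _ => szf i)) => -> //; last first.
  by rewrite (leq_trans jh)// leq_addr.
by rewrite nth_cat size_map jh (nth_map 0%N).
Qed.

(** Serves to find the subcolumn that a given spacer belongs to. *)
Lemma block_of_lt_sum (a : nat -> nat) (m v : nat) : (v < \sum_(k < m) a k)%N ->
  exists2 k, (k < m)%N & exists2 t, (t < a k)%N & v = (\sum_(i < k) a i + t)%N.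
Proof.
elim: m => [|m IH]; first by rewrite big_ord0.
rewrite big_ord_recr /=; case: (ltnP v (\sum_(k < m) a k)) => [/IH[k km kt] _|vm vlt].
  by exists k => //; rewrite ltnW.
exists m => //; exists (v - \sum_(k < m) a k)%N; last by rewrite subnKC.
by rewrite ltn_subLR.
Qed.

(** There are no gaps between levels. A position below [h n * r n] comes from cutting an old level,
    found by Euclidean division by [r n]; the later positions are those of the spacers. *)
Lemma iota_sub_col_pos n : {subset iota 0 (h n) <= col_pos n}.
Proof.
elim: n => // n IH v; rewrite mem_iota add0n /= size_col_posSE => vlt.
have r0 : (0 < r n)%N by rewrite (leq_trans _ (r_ge2 n)).
apply/flattenP => /=; case: (ltnP v (h n * r n)) => [vh|hv].
  eexists; first by apply: map_f; rewrite mem_iota add0n /=; exact: (ltn_pmod v r0).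
  rewrite mem_cat; apply/orP; left; apply/mapP; exists (v %/ r n)%N.
    by apply: IH; rewrite mem_iota /= add0n ltn_divLR.
  exact: divn_eq.
have [|k kr [t ts vE]] := @block_of_lt_sum (s n) (r n) (v - h n * r n)%N.
  by rewrite ltn_subLR.
eexists; first by apply: map_f; rewrite mem_iota add0n /=; exact: kr.
rewrite mem_cat; apply/orP; right; apply/mapP; exists t.
  by rewrite mem_iota add0n.
by rewrite -vE subnKC.
Qed.

(** By pigeonhole: a list of length [h n] that contains all [h n] numbers of [iota 0 (h n)] has no
    repetition. Disjointness of the levels rests on this. *)
Lemma col_pos_uniq n : uniq (col_pos n).
Proof.
by apply: (leq_size_uniq (iota_uniq 0 (h n)) (@iota_sub_col_pos n)); rewrite size_iota.
Qed.

End Columns.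

(** * Levels as sets of reals, nesting of columns, and the map [T] on levels *)

Section Levels.
Variables (R : realType) (ell : R) (r : nat -> nat) (s : nat -> nat -> nat).
Hypotheses (ell_gt0 : 0 < ell) (r_ge2 : forall n, (2 <= r n)%N).

Local Notation w := (cs_width ell r).
Local Notation h := (cs_h ell r s).
Local Notation col := (cs_col ell r s).
Local Notation level := (cs_level ell r s).
Local Notation off := (col_offset r s).
Local Notation pos := (col_pos r s).
Local Notation T := (cs_T ell r s).

Let r_gt0 n : (0 < r n)%N. Proof. by rewrite (leq_trans _ (r_ge2 n)). Qed.

Lemma cs_width_gt0 n : 0 < w n.
Proof. by rewrite divr_gt0// ltr0n prodn_gt0. Qed.

Lemma cs_widthS n : w n = (r n)%:R * w n.+1.
Proof.
rewrite /cs_width big_ord_recr /= natrM.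
have p0 : (\prod_(i < n) r i)%:R != 0 :> R by rewrite pnatr_eq0 -lt0n prodn_gt0.
have q0 : (r n)%:R != 0 :> R by rewrite pnatr_eq0 -lt0n.
by field; rewrite p0 q0.
Qed.

(** Passing to the finer unit [w n.+1] multiplies the old positions by [r n], exactly as in the
    recursion of [col_pos]. From here on levels are handled through integers. *)
Lemma cs_colME n : cs_colM ell r s n =
  ([seq q%:R * w n | q <- pos n], (size (pos n))%:R * w n).
Proof.
elim: n => [|n IH].
  by rewrite /= /cs_width big_ord0 mul0r mul1r divr1.
rewrite [LHS]/= IH /=; congr pair.
  rewrite map_flatten -map_comp; congr flatten; apply: eq_map => k /=.
  rewrite map_cat -!map_comp; congr cat; apply: eq_map => q /=.
    by rewrite cs_widthS natrD natrM; ring.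
  by rewrite cs_widthS !natrD natrM; ring.
rewrite -/(pos n.+1) size_col_posSE// cs_widthS natrD natrM; ring.
Qed.

Lemma cs_hE n : h n = size (pos n).
Proof. by rewrite /cs_h /cs_col cs_colME /= size_map. Qed.

Lemma nth_cs_col n j : (j < h n)%N ->
  nth 0 (col n) j = (nth 0%N (pos n) j)%:R * w n.
Proof. by rewrite cs_hE => jh; rewrite /cs_col cs_colME /= (nth_map 0%N). Qed.

Lemma cs_h_gt0 n : (0 < h n)%N.
Proof. by rewrite cs_hE size_col_pos_gt0. Qed.

Lemma cs_hS n : h n.+1 = off n (r n).
Proof. by rewrite cs_hE size_col_posS. Qed.

(** In units of [w n] the levels are unit cells, which [Num.truncn] identifies. The condition
    [0 <= x] excludes negative reals, on which [Num.truncn] takes the default value 0. *)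
Lemma cs_levelP n j x : (j < h n)%N ->
  level n j x <-> 0 <= x /\ Num.truncn (x / w n) = nth 0%N (pos n) j.
Proof.
move=> jh; rewrite /cs_level /= nth_cs_col//; set q := nth _ _ _.
have w0 := cs_width_gt0 n.
have -> : q%:R * w n + w n = q.+1%:R * w n by rewrite -natr1; ring.
rewrite -ler_pdivlMr// -ltr_pdivrMr//; split=> [/[dup] qx /truncn_def ->|[x0 <-]].
  split=> //; case/andP: qx => + _; rewrite ler_pdivlMr//; apply: le_trans.
  by rewrite mulr_ge0// ltW.
by apply: truncn_itv; rewrite divr_ge0// ltW.
Qed.

Lemma truncn_width n x : 0 <= x ->
  Num.truncn (x / w n) = (Num.truncn (x / w n.+1) %/ r n)%N.
Proof.
move=> x0; have w0 := cs_width_gt0 n.+1.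
have rR : 0 < (r n)%:R :> R by rewrite ltr0n.
have -> : x / w n = x / w n.+1 / (r n)%:R.
  by rewrite cs_widthS; field; rewrite !gt_eqF.
set y := x / w n.+1; have y0 : 0 <= y by rewrite divr_ge0// ltW.
have /andP[Qy yQ] := truncn_itv y0.
apply: truncn_def; rewrite ler_pdivlMr// ltr_pdivrMr//; apply/andP; split.
  by rewrite (le_trans _ Qy)// -natrM ler_nat leq_divM.
by rewrite (lt_le_trans yQ)// -natrM ler_nat ltn_ceil.
Qed.

Lemma cs_level_inj n i j x : (i < h n)%N -> (j < h n)%N ->
  level n i x -> level n j x -> i = j.
Proof.
move=> ih jh /(cs_levelP _ ih)[_ ti] /(cs_levelP _ jh)[_] /eqP; rewrite ti.
by rewrite nth_uniq -?cs_hE ?col_pos_uniq// => /eqP.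
Qed.

Lemma cs_H_offset n k : (k < r n)%N -> off n k \in cs_H ell r s n.
Proof.
case: k => [|k] kr; first by rewrite /col_offset big_ord0 inE eqxx.
rewrite inE; apply/orP; right; apply/mapP; exists k.
  by rewrite mem_iota add0n /= -(ltn_add2r 1%N) !addn1 prednK.
by apply: eq_bigr => i _; rewrite /cs_hnk cs_hE.
Qed.

Lemma offset_lt n k j : (k < r n)%N -> (j < h n)%N -> (off n k + j < h n.+1)%N.
Proof.
move=> kr jh; rewrite cs_hS (leq_trans _ (col_offset_mono r s n kr))//.
by rewrite col_offsetS -cs_hE; lia.
Qed.

Lemma nth_cs_colS n k j : (k < r n)%N -> (j < h n)%N ->
  nth 0 (col n.+1) (off n k + j) = nth 0 (col n) j + k%:R * w n.+1.
Proof.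
move=> kr jh; rewrite nth_cs_col ?offset_lt// nth_cs_col//.
by rewrite nth_col_posS// -?cs_hE// [w n]cs_widthS natrD natrM; ring.
Qed.

(** The index of the cell of width [w n.+1] containing [x], divided by [r n], has the position of
    the old level as quotient and the subcolumn as remainder. *)
Lemma cs_level_step n j x : (j < h n)%N -> level n j x ->
  exists2 k, (k < r n)%N & level n.+1 (off n k + j) x.
Proof.
move=> jh /(cs_levelP _ jh)[x0 tx].
exists (Num.truncn (x / w n.+1) %% r n)%N; first by rewrite ltn_pmod.
apply/cs_levelP; first by rewrite offset_lt// ltn_pmod.
split=> //; rewrite nth_col_posS ?ltn_pmod// -?cs_hE//.
by rewrite -tx (@truncn_width n)// -divn_eq.
Qed.

(* C_m contains a copy of C_n through x, starting at height D and translated by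
   del; the digits d of D are set to 0 outside of n <= i < m. *)
Lemma cs_level_descend n m j x : (n <= m)%N -> (j < h n)%N -> level n j x ->
  exists D del (d : nat -> nat),
   [/\ forall i, d i \in cs_H ell r s i,
       forall i, ~~ (n <= i < m)%N -> d i = 0%N,
       D = (\sum_(i < m) d i)%N,
       forall j', (j' < h n)%N ->
         (D + j' < h m)%N /\ nth 0 (col m) (D + j') = nth 0 (col n) j' + del
     & level m (D + j) x].
Proof.
move=> nm jh lx; elim: m nm => [|m IH].
  rewrite leqn0 => /eqP n0; subst n; exists 0%N, 0, (fun=> 0%N).
  split=> //; first by rewrite big_ord0.
  by move=> j' jh'; rewrite add0n addr0.
rewrite leq_eqVlt => /orP[/eqP nE|]; last first.
  rewrite ltnS => nm; have [D [del [d [dH d0 DE tr lD]]]] := IH nm.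
  have [k kr lk] := cs_level_step (tr _ jh).1 lD.
  exists (off m k + D)%N, (del + k%:R * w m.+1).
  (* The subcolumn [k] of [C_m] that contains [x] contributes the new digit, of index [m]. *)
  exists (fun i => if i == m then off m k else d i); split.
  - by move=> i; case: eqP => [->|_]; [exact: cs_H_offset|exact: dH].
  - move=> i im; case: eqP => [iE|/eqP im']; last by apply: d0; lia.
    by move: im; rewrite iE nm ltnSn.
  - rewrite big_ord_recr /= eqxx DE addnC; congr addn; apply: eq_bigr => i _.
    by rewrite ltn_eqF.
  - move=> j' jh'; have [Dh cD] := tr _ jh'; rewrite -addnA offset_lt//.
    by rewrite nth_cs_colS// cD addrA.
  - by rewrite -addnA.
subst n; exists 0%N, 0, (fun=> 0%N); split=> //.
- by rewrite big1.
- by move=> j' jh'; rewrite add0n addr0.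
Qed.

(** [cs_T] picks some level containing [x], so independence of the choice is at stake. Both columns
    have translated copies in the later one of the two; there [x] lies in a single level, so both
    choices give the same translation. *)
Lemma cs_T_level n j x : (j.+1 < h n)%N -> level n j x ->
  T x = x - nth 0 (col n) j + nth 0 (col n) j.+1.
Proof.
move=> jh lx; rewrite /cs_T; case: pselect => [e|]; last by case; exists (n, j).
case: (cid e) => -[n' j'] /= [jh' lx'].
have [D [del [d [_ _ _ tr lD]]]] :=
  cs_level_descend (leq_maxl n n') (ltnW jh) lx.
have [D' [del' [d' [_ _ _ tr' lD']]]] :=
  cs_level_descend (leq_maxr n n') (ltnW jh') lx'.
have E := cs_level_inj (tr _ (ltnW jh)).1 (tr' _ (ltnW jh')).1 lD lD'.
have := (tr _ jh).2; have := (tr' _ jh').2.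
have := (tr _ (ltnW jh)).2; have := (tr' _ (ltnW jh')).2.
rewrite !addnS E; lra.
Qed.

(** * Iterates of [T] and digit expansions of return times *)

Hypothesis normal : cs_normal s r.

(** Take a stage [m] at which spacers are put above the last subcolumn. In [C_{m+1}] every level
    coming from [C_m] has something above it: the rest of its subcolumn, the next subcolumn, or
    those spacers. *)
Lemma cs_normal_not_top x M : cs_X ell r s x ->
  exists n j, [/\ (M <= n)%N, (j.+1 < h n)%N & level n j x].
Proof.
case=> n [j [jh lx]]; have [m mM s0] := normal (maxn M n).
have nm : (n <= m)%N by rewrite (leq_trans _ mM)// leq_maxr.
have [D [del [d [_ _ _ tr lD]]]] := cs_level_descend nm jh lx.
have [k kr lk] := cs_level_step (tr _ jh).1 lD.
exists m.+1, (off m k + (D + j))%N; split=> //.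
  by rewrite ltnW// ltnS (leq_trans _ mM)// leq_maxl.
have Dh := (tr _ jh).1; rewrite cs_hS.
have [kl|kl] := ltnP k.+1 (r m).
  have := col_offset_mono r s m kl; rewrite !col_offsetS -!cs_hE.
  by have := cs_h_gt0 m; lia.
have kE : k = (r m).-1 by move: kr kl; have := r_gt0 m; lia.
rewrite -(prednK (r_gt0 m)) -kE col_offsetS -cs_hE.
by move: s0; rewrite -kE; lia.
Qed.

(** A late enough column contains the whole orbit segment, so that [T^k] climbs [k] levels in it.
    Each application of [T] may require moving on to a later column. *)
Lemma cs_T_iter_level k x M : cs_X ell r s x ->
  exists m p, [/\ (M <= m)%N, (p + k < h m)%N, level m p x &
    iter k T x = x - nth 0 (col m) p + nth 0 (col m) (p + k)].
Proof.
move=> Xx; elim: k => [|k [m [p [mM ph lp Ty]]]].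
  have [n [j [nM jh lj]]] := cs_normal_not_top M Xx.
  by exists n, j; split=> //; rewrite addn0 ?subrK// ltnW.
have ly : level m (p + k) (iter k T x).
  by rewrite Ty; move: lp; rewrite /cs_level /=; lra.
have [n [j [nm jh lj]]] := cs_normal_not_top m (ex_intro _ m (ex_intro _ _ (conj ph ly))).
have p'h : (p < h m)%N by rewrite (leq_ltn_trans (leq_addr k p)).
have [D [del [d [_ _ _ tr lD]]]] := cs_level_descend nm p'h lp.
(* The copy of [C_m] through [x] also contains [T^k x], still [k] levels higher. *)
have [Dph Dpc] := tr _ p'h; have [Dkh Dkc] := tr _ ph.
have ly' : level n (D + (p + k)) (iter k T x).
  by rewrite Ty; move: lD; rewrite /cs_level /= Dkc Dpc; lra.
have jE := cs_level_inj (ltnW jh) Dkh lj ly'.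
exists n, (D + p)%N; split => //.
- exact: leq_trans nm.
- by rewrite addnS -addnA -jE.
- rewrite iterS (cs_T_level jh lj) addnS -addnA -jE; move: Dkc; rewrite -jE.
  rewrite Ty Dpc; lra.
Qed.

Lemma sum_ord_zero_tail (d : nat -> nat) m M : (m <= M)%N ->
  (forall i, (m <= i)%N -> d i = 0%N) ->
  (\sum_(i < M) d i = \sum_(i < m) d i)%N.
Proof.
move=> mM d0; rewrite -(subnKC mM) big_split_ord /= [X in (_ + X)%N]big1 ?addn0// => i _.
by rewrite d0// leq_addr.
Qed.

(* The sums stabilise; stating them for all large M allows two return times to be
   compared at a common stage. *)
Lemma cs_return_time N i j k x :
  (i < h N)%N -> (j < h N)%N -> level N j x -> level N i (iter k T x) ->
  exists m (e e' : nat -> nat),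
   [/\ forall l, e l \in cs_H ell r s l /\ e' l \in cs_H ell r s l,
       forall l, (l < N)%N -> e l = 0%N /\ e' l = 0%N &
       forall M, (m <= M)%N ->
       (k + j + \sum_(l < M) e' l = i + \sum_(l < M) e l)%N].
Proof.
move=> ih jh lj li.
have [m [p [Nm pk lp Tx]]] := cs_T_iter_level k N (ex_intro _ N (ex_intro _ j (conj jh lj))).
have ph : (p < h m)%N by rewrite (leq_ltn_trans (leq_addr k p)).
have lpk : level m (p + k) (iter k T x).
  by rewrite Tx; move: lp; rewrite /cs_level /=; lra.
have [D' [del' [e' [e'H e'0 D'E tr' lD']]]] := cs_level_descend Nm jh lj.
have [D [del [e [eH e0 DE tr lD]]]] := cs_level_descend Nm ih li.
(* Here [p = D' + j] and [p + k = D + i], where [D'] and [D] are the heights in [C_m] of the copies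
   of [C_N] through [x] and [T^k x]. *)
have pE := cs_level_inj ph (tr' _ jh).1 lp lD'.
have pkE := cs_level_inj pk (tr _ ih).1 lpk lD.
exists m, e, e'; split.
- by move=> l.
- by move=> l lN; split; [apply: e0|apply: e'0]; lia.
- move=> M mM; rewrite !(sum_ord_zero_tail mM) -?D'E -?DE; first lia.
    by move=> l ml; apply: e0; lia.
  by move=> l ml; apply: e'0; lia.
Qed.

(** * Uniqueness of digits and disjointness of return times *)

Hypothesis direct : forall (N : nat) (d d' e e' : nat -> nat),
  (forall i, (i < N)%N ->
     [/\ d i \in cs_H ell r s i, d' i \in cs_H ell r s i,
         e i \in cs_H ell r s i & e' i \in cs_H ell r s i]) ->
  \sum_(i < N) ((d i)%:Z - (d' i)%:Z) = \sum_(i < N) ((e i)%:Z - (e' i)%:Z) ->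
  forall i, (i < N)%N -> (d i)%:Z - (d' i)%:Z = (e i)%:Z - (e' i)%:Z.

(* The return from p to p makes the digits of k below N vanish, while the return
   from p' to p makes them the digits of p - p'. *)
Lemma cs_return_times_disjoint n N j p p' k x y z :
  (n <= N)%N -> (j < h n)%N -> (p < h N)%N -> (p' < h N)%N ->
  level n j x -> level N p x -> level n j z -> level N p' z ->
  level N p y -> level N p (iter k T y) -> level N p (iter k T z) -> p = p'.
Proof.
move=> nN jh ph p'h ljx lpx ljz lpz lpy lTy lTz.
have [D [del [d [dH d0 DE tr lD]]]] := cs_level_descend nN jh ljx.
have [D' [del' [d' [d'H d'0 D'E tr' lD']]]] := cs_level_descend nN jh ljz.
have pE := cs_level_inj ph (tr _ jh).1 lpx lD.
have p'E := cs_level_inj p'h (tr' _ jh).1 lpz lD'.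
have [m [e [e' [eH e0 eE]]]] := cs_return_time ph ph lpy lTy.
have [m' [f [f' [fH f0 fE]]]] := cs_return_time ph p'h lpz lTz.
pose M := maxn N (maxn m m').
have NM : (N <= M)%N by rewrite leq_maxl.
have /eE : (m <= M)%N by rewrite /M; lia.
have /fE : (m' <= M)%N by rewrite /M; lia.
move=> {}fE {}eE.
have dM := @sum_ord_zero_tail d N M NM (fun i Ni => d0 i ltac:(lia)).
have d'M := @sum_ord_zero_tail d' N M NM (fun i Ni => d'0 i ltac:(lia)).
(* The digits of [D] vanish from [N] on and those of [f] vanish below [N], so gluing them keeps
   every digit in its [H_i] and adds the sums. *)
pose g i := if (i < N)%N then d i else f i.
pose g' i := if (i < N)%N then d' i else f' i.
have gE i : g i = (d i + f i)%N.
  rewrite /g; case: ltnP => iN; first by rewrite (f0 i iN).1 addn0.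
  by rewrite d0 //; lia.
have g'E i : g' i = (d' i + f' i)%N.
  rewrite /g'; case: ltnP => iN; first by rewrite (f0 i iN).2 addn0.
  by rewrite d'0 //; lia.
have sumZ (a b : nat -> nat) : \sum_(i < M) ((a i)%:Z - (b i)%:Z) =
    (\sum_(i < M) a i)%N%:Z - (\sum_(i < M) b i)%N%:Z.
  by rewrite sumrB !(big_morph Posz PoszD erefl).
(* Both families of differences sum to [k]: the copy heights [D], [D'] enter through [p = D + j] and
   [p' = D' + j]. *)
have key : forall i, (i < M)%N ->
    (g i)%:Z - (g' i)%:Z = (e i)%:Z - (e' i)%:Z.
  apply: direct => [i iM|].
    have [? ?] := fH i; have [? ?] := eH i; rewrite /g /g'.
    by case: ifP => _; split.
  rewrite !sumZ (eq_bigr _ (fun (i : 'I_M) _ => gE i)).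
  rewrite (eq_bigr _ (fun (i : 'I_M) _ => g'E i)) !big_split /= dM d'M -DE -D'E.
  move: fE eE; rewrite pE p'E.
  move: (\sum_(l < M) f' l)%N (\sum_(l < M) f l)%N => F' F.
  move: (\sum_(l < M) e' l)%N (\sum_(l < M) e l)%N => E' E.
  lia.
suff DD : D = D' by rewrite pE p'E DD.
rewrite DE D'E; apply: eq_bigr => i _.
have := key i (leq_trans (ltn_ord i) NM); rewrite /g /g' ltn_ord.
by rewrite (e0 i (ltn_ord i)).1 (e0 i (ltn_ord i)).2; lia.
Qed.

End Levels.

(** * Sets of positive measure and a criterion against rational weak mixing *)

Import numFieldNormedType.Exports.
Local Open Scope classical_set_scope.

(** Otherwise [F] would be a countable union of negligible sets. *)
Lemma measure_gt0_piece (R : realType) (F : set R) (G : nat -> set R) :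
  measurable F -> (forall n, measurable (G n)) -> F `<=` \bigcup_n G n ->
  (0 < @lebesgue_measure R F)%E ->
  exists n, (0 < @lebesgue_measure R (F `&` G n))%E.
Proof.
move=> mF mG FG F0; apply: contrapT => /forallNP noG.
have G0 n : (@lebesgue_measure R).-negligible (F `&` G n).
  apply/negligibleP; first exact: (measurableI _ _ mF (mG n)).
  apply/eqP; rewrite eq_le measure_ge0 andbT leNgt; apply/negP; exact: noG.
have : (@lebesgue_measure R).-negligible F.
  rewrite (_ : F = \bigcup_n (F `&` G n)); first exact: negligible_bigcup.
  by rewrite -setI_bigcupr; apply/esym/setIidl.
by move/negligibleP => /(_ mF) F00; rewrite F00 ltxx in F0.
Qed.

Lemma muR_gt0 (R : realType) (A F : set R) :
  measurable A -> measurable F -> A `<=` F ->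
  (0 < @lebesgue_measure R A)%E -> (@lebesgue_measure R F < +oo)%E -> 0 < muR A.
Proof.
move=> mA mF AF A0 Foo; apply: fine_gt0; rewrite A0 /=.
by rewrite (le_lt_trans _ Foo)// le_measure ?inE.
Qed.

Lemma u_k_ge0 (R : realType) (T : R -> R) k F : 0 <= u_k T k F.
Proof. by rewrite divr_ge0 ?sqr_ge0// fine_ge0// measure_ge0. Qed.

(* Every k contributes mu(A) min(mu(A), mu(B)) u_k(F) to one of the two sums
   attached to (A, A) and (A, B), so these cannot both be o(a_n(F)). *)
Lemma not_rationally_weakly_mixing_disjoint_returns (R : realType)
    (X : set R) (T : R -> R) :
  (forall F : set R, measurable F -> F `<=` X -> (0 < @lebesgue_measure R F)%E ->
    exists A B : set R,
      [/\ measurable A /\ measurable B, A `<=` F /\ B `<=` F,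
          (0 < @lebesgue_measure R A)%E /\ (0 < @lebesgue_measure R B)%E &
          forall k, A `&` iter k T @` A = set0 \/ A `&` iter k T @` B = set0]) ->
  ~ rationally_weakly_mixing X T.
Proof.
move=> disj [F [mF FX /andP[F0 Foo] _ mix]].
have [A [B [[mA mB] [AF BF] [A0 B0] AB]]] := disj F mF FX F0.
have muA0 := muR_gt0 mA mF AF A0 Foo; have muB0 := muR_gt0 mB mF BF B0 Foo.
have muF0 := muR_gt0 mF mF (@subset_refl _ F) F0 Foo.
pose c := Num.min (muR A * muR A) (muR A * muR B).
have c0 : 0 < c by rewrite lt_min !mulr_gt0.
have := cvgD (mix A A mA mA AF AF) (mix A B mA mB AF BF).
rewrite addr0 => /(_ _) /cvgrPdist_lt/(_ _ c0)[n0 _ /(_ n0.+1 (leqnSn n0))].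
rewrite sub0r normrN fctE; set S1 := \sum_(k < _) _; set S2 := \sum_(k < _) _.
(* The index [n0.+1] makes the sum nonempty; its term [k = 0] is [1 / mu(F)], which is positive. *)
have a0 : 0 < a_n T n0.+1 F.
  rewrite /a_n big_ord_recl ltr_wpDr//; first by apply: sumr_ge0 => *; exact: u_k_ge0.
  by rewrite /u_k /= image_id setIid divr_gt0// exprn_gt0.
have le_sum : c * a_n T n0.+1 F <= S1 + S2.
  rewrite /a_n /S1 /S2 mulr_sumr -big_split /=; apply: ler_sum => k _.
  have uk := u_k_ge0 T k F.
  have muR0 : muR (set0 : set R) = 0 by rewrite /muR measure0.
  case: (AB k) => ->; rewrite muR0 sub0r normrN.
    rewrite (@le_trans _ _ (muR A * muR A * u_k T k F))//.
      by rewrite ler_wpM2r// ge_min lexx.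
    by rewrite ger0_norm ?lerDl// (mulr_ge0 _ uk)// mulr_ge0// ltW.
  rewrite (@le_trans _ _ (muR A * muR B * u_k T k F))//.
    by rewrite ler_wpM2r// ge_min lexx orbT.
  by rewrite [X in _ + X]ger0_norm ?lerDr// (mulr_ge0 _ uk)// mulr_ge0// ltW.
rewrite -mulrDr ger0_norm; last first.
  by rewrite mulr_ge0 ?invr_ge0 ?(ltW a0)// addr_ge0//; apply: sumr_ge0.
by rewrite mulrC ltr_pdivrMr// ltNge le_sum.
Qed.

(** * Levels that meet a given set in positive measure *)

Section Pieces.
Variables (R : realType) (ell : R) (r : nat -> nat) (s : nat -> nat -> nat).
Hypotheses (ell_gt0 : 0 < ell) (r_ge2 : forall n, (2 <= r n)%N).

Local Notation w := (cs_width ell r).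
Local Notation h := (cs_h ell r s).
Local Notation level := (cs_level ell r s).
Local Notation mu := (@lebesgue_measure R).

Lemma cs_levelE n j :
  level n j = `[nth 0 (cs_col ell r s n) j, nth 0 (cs_col ell r s n) j + w n[.
Proof. by rewrite set_itvco. Qed.

Lemma measurable_cs_level n j : measurable (level n j).
Proof. by rewrite cs_levelE; exact: measurable_itv. Qed.

Lemma lebesgue_measure_cs_level n j : mu (level n j) = (w n)%:E.
Proof.
rewrite cs_levelE lebesgue_measure_itv /= lte_fin ltrDl cs_width_gt0//.
by rewrite -EFinB addrAC subrr add0r.
Qed.

(** As each [r i] is at least 2, the widths decay at least like [ell / 2^N]. *)
Lemma cs_width_small (eps : R) n : 0 < eps -> exists2 N, (n <= N)%N & w N < eps.
Proof.
move=> e0; pose M := (Num.truncn (ell / eps)).+1.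
exists (maxn n M); first exact: leq_maxl.
have pow m : (2 ^ m <= \prod_(i < m) r i)%N.
  elim: m => [|m IH]; first by rewrite big_ord0.
  by rewrite expnSr big_ord_recr leq_mul.
rewrite ltr_pdivrMr ?ltr0n ?(leq_trans _ (pow _)) ?expn_gt0//.
rewrite mulrC -ltr_pdivrMr// (lt_le_trans (truncnS_gt _))// ler_nat.
rewrite -/M (leq_trans _ (pow _))// (leq_trans (leq_maxr n M))//.
by rewrite ltnW// ltn_expl.
Qed.

(** The levels of [C_N] cover those of [C_n]; the cover is indexed by all naturals, with empty sets
    from [h N] on. *)
Lemma cs_level_gt0_piece n j (F : set R) N : measurable F -> (n <= N)%N ->
  (j < h n)%N -> F `<=` level n j -> (0 < mu F)%E ->
  exists2 p, (p < h N)%N & (0 < mu (F `&` level N p))%E.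
Proof.
move=> mF nN jh FJ F0.
have [||p] := @measure_gt0_piece R F
    (fun p => if (p < h N)%N then level N p else set0) mF _ _ F0.
- by move=> p; case: ifP => _; [exact: measurable_cs_level|exact: measurable0].
- move=> x /FJ lx.
  have [D [del [d [_ _ _ tr lD]]]] := cs_level_descend ell_gt0 r_ge2 nN jh lx.
  by exists (D + j)%N => //; rewrite (tr _ jh).1.
- by case: ifP => [ph Fp|_]; [exists p|rewrite setI0 measure0 ltxx].
Qed.

Lemma cs_X_gt0_piece (F : set R) : measurable F -> F `<=` cs_X ell r s ->
  (0 < mu F)%E ->
  exists n j, (j < h n)%N /\ (0 < mu (F `&` level n j))%E.
Proof.
move=> mF FX F0.
pose G n j := if (j < h n)%N then level n j else set0.
have mG n j : measurable (G n j).
  by rewrite /G; case: ifP => _; [exact: measurable_cs_level|exact: measurable0].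
have mG' n : measurable (\bigcup_j G n j) by exact: bigcup_measurable.
have [|n Fn] := measure_gt0_piece mF mG' _ F0.
  by move=> x /FX[n [j [jh lx]]]; exists n => //; exists j => //; rewrite /G jh.
have [|j] := measure_gt0_piece (measurableI _ _ mF (mG' n)) (mG n) _ Fn.
  by move=> x [].
rewrite /G; case: ifP => [jh Fj|_]; last by rewrite setI0 measure0 ltxx.
exists n, j; split => //; apply: (lt_le_trans Fj).
have mL := measurable_cs_level n j.
apply: le_measure; rewrite ?inE; first exact: measurableI (measurableI _ _ mF (mG' n)) mL.
  exact: measurableI mF mL.
by apply: setSI; exact: subIsetl.
Qed.

Lemma two_gt0_pieces (F : set R) : measurable F -> F `<=` cs_X ell r s ->
  (0 < mu F)%E ->
  exists n N j p p', [/\ (n <= N)%N, (j < h n)%N, (p < h N)%N /\ (p' < h N)%N,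
    p <> p' & (0 < mu (F `&` level n j `&` level N p))%E /\
              (0 < mu (F `&` level n j `&` level N p'))%E].
Proof.
move=> mF FX F0; have [n [j [jh FJ0]]] := cs_X_gt0_piece mF FX F0.
set J := F `&` level n j in FJ0 *.
have mJ : measurable J by apply: measurableI => //; exact: measurable_cs_level.
(* This bound makes [mu J] finite, so that [fine (mu J)] is its true value. *)
have Jw : (mu J <= (w n)%:E)%E.
  rewrite -(lebesgue_measure_cs_level n j); apply: le_measure; rewrite ?inE//.
    exact: measurable_cs_level.
  exact: subIsetr.
have Jfin : mu J \is a fin_num by rewrite ge0_fin_numE// (le_lt_trans Jw)// ltry.
have [|N nN wN] := @cs_width_small (fine (mu J)) n.
  by apply: fine_gt0; rewrite FJ0 (le_lt_trans Jw)// ltry.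
have JJ : J `<=` level n j by move=> x [].
have [p ph Jp] := cs_level_gt0_piece mJ nN jh JJ FJ0.
have mp := measurable_cs_level N p.
have mD : measurable (J `\` level N p) by exact: measurableD.
(* If removing the level [p] left a null set, [mu J] would be at most [w N], against the choice of
   [N]. The remainder then yields the second level [p']. *)
have D0 : (0 < mu (J `\` level N p))%E.
  rewrite lt_neqAle measure_ge0 andbT eq_sym; apply/eqP => D00.
  have : (mu J <= (w N)%:E)%E.
    rewrite -(setUIDK J (level N p)) (le_trans (measureU2 _ _ _))//.
      exact: measurableI.
    rewrite [X in (_ + X)%E](D00 : _ = 0%E) adde0 -(lebesgue_measure_cs_level N p).
    by apply: le_measure; rewrite ?inE//; exact: measurableI.
  by rewrite -(fineK Jfin) lee_fin leNgt wN.
have [|p' p'h Dp'] := cs_level_gt0_piece mD nN jh _ D0; first by move=> x [/JJ].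
have mp' := measurable_cs_level N p'.
exists n, N, j, p, p'; split => //.
  move=> pp'; move: Dp'; rewrite -pp' (_ : _ `&` _ = set0) ?measure0 ?ltxx//.
  by apply/seteqP; split => x // [[]].
split => //; apply: (lt_le_trans Dp').
apply: le_measure; rewrite ?inE; do ?exact: measurableI.
by apply: setSI; exact: subDsetl.
Qed.

End Pieces.

Theorem mainTheorem16 (R : realType) (ell : R) (r : nat -> nat)
    (s : nat -> nat -> nat) :
  0 < ell ->
  (forall n, (2 <= r n)%N) ->
  cs_normal s r ->
  (forall (N : nat) (d d' e e' : nat -> nat),
      (forall i, (i < N)%N ->
         [/\ d i \in cs_H ell r s i, d' i \in cs_H ell r s i,
             e i \in cs_H ell r s i & e' i \in cs_H ell r s i]) ->
      \sum_(i < N) ((d i)%:Z - (d' i)%:Z) = \sum_(i < N) ((e i)%:Z - (e' i)%:Z) ->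
      forall i, (i < N)%N -> (d i)%:Z - (d' i)%:Z = (e i)%:Z - (e' i)%:Z) ->
  ~ rationally_weakly_mixing (cs_X ell r s) (cs_T ell r s).
Proof.
move=> ell_gt0 r_ge2 normal direct.
apply: not_rationally_weakly_mixing_disjoint_returns => F mF FX F0.
have [n [N [j [p [p' [nN jh [ph p'h] pp' [A0 B0]]]]]]] :=
  two_gt0_pieces ell_gt0 r_ge2 mF FX F0.
have mL n' j' : measurable (cs_level ell r s n' j') by exact: measurable_cs_level.
exists (F `&` cs_level ell r s n j `&` cs_level ell r s N p).
exists (F `&` cs_level ell r s n j `&` cs_level ell r s N p'); split => //.
- by split; do !apply: measurableI => //.
- by split=> x [[]].
move=> k; set A := F `&` _ `&` cs_level ell r s N p.
have [|/set0P[x [[[_ ljx] lpx] [y [[_ _] lpy] yx]]]] :=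
  eqVneq (A `&` iter k (cs_T ell r s) @` A) set0; first by left.
(* A point of [A] in [T^k A] and one in [T^k B] give returns to level [p] at the same time [k], one
   from [p] and one from [p'], which forces [p = p']. *)
right; apply/seteqP; split => // x' [[[_ _] lpx'] [z [[_ ljz] lpz] zx']].
apply: pp'; rewrite -yx in ljx lpx; rewrite -zx' in lpx'.
exact: (cs_return_times_disjoint ell_gt0 r_ge2 normal direct nN jh ph p'h
  ljx lpx ljz lpz lpy lpx lpx').
Qed.
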